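(* Let $\Gamma_n = \{0, 1, \dots, n-1\} \times \{0, 1, \dots, n-1\} \subseteq \mathbb{R}^2$ be the standard $n \times n$ grid and let $k \ge 1$ be an integer. As $n \to \infty$, the smallest $k$-cover of $\Gamma_n$ that only contains lines of slope $0$, $\infty$, or $-1$ has size at least $(\sqrt{2} + o(1))\,k(n-1)$.
   Context: For an integer $k \ge 1$, a $k$-cover of a finite grid $\Gamma \subseteq \mathbb{R}^2$ containing $(0,0)$ is a finite multiset $\mathcal{H}$ of (affine) lines in $\mathbb{R}^2$ such that every point of $\Gamma \setminus \{(0,0)\}$ is contained in at least $k$ of the lines (counted with multiplicity), while no line of $\mathcal{H}$ contains $(0,0)$. The size of a $k$-cover is its cardinality counted with multiplicity. Lines of slope $\infty$ are the vertical lines. Here $o(1)$ denotes a quantity depending only on $n$ (uniform in $k$) that tends to $0$ as $n \to \infty$. *)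

(* Defs.v *)
From mathcomp Require Import all_boot all_order all_algebra.
From mathcomp Require Import finmap multiset.
From mathcomp Require Import all_classical all_reals all_analysis.
Import Order.TTheory GRing.Theory Num.Theory.
Import numFieldNormedType.Exports.

Set Implicit Arguments.
Unset Strict Implicit.
Unset Printing Implicit Defensive.

Local Open Scope classical_set_scope.
Local Open Scope ring_scope.

Definition is_line (R : realType) (L : set (R * R)) : Prop :=
  exists a b c : R,
    (a != 0 \/ b != 0) /\ L = [set p | a * p.1 + b * p.2 = c].

Definition has_slope (R : realType) (m : R) (L : set (R * R)) : Prop :=
  exists b : R, L = [set p | p.2 = m * p.1 + b].

(* Slope infinity. *)
Definition vertical (R : realType) (L : set (R * R)) : Prop :=
  exists a : R, L = [set p | p.1 = a].

Definition std_grid (R : realType) (n : nat) : set (R * R) :=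
  [set p | exists i j : nat, [/\ (i < n)%N, (j < n)%N & p = (i%:R, j%:R)]].

(* [count] and [size] act on the enumeration of the multiset [H], in which
   each line is repeated according to its multiplicity. *)
Definition is_cover (R : realType) (G : set (R * R)) (k : nat)
    (H : multiset (set (R * R))) : Prop :=
  [/\ forall L, L \in H -> is_line L,
      forall p, G p -> p <> (0, 0) -> (k <= count (fun L => p \in L) H)%N
    & forall L, L \in H -> ~ L (0, 0)].

(* Main.v *)
Require Import Defs.
From mathcomp Require Import all_boot all_order all_algebra.
From mathcomp Require Import finmap multiset.
From mathcomp Require Import all_classical all_reals all_analysis.
From mathcomp Require Import zify ring lra.
Import Order.TTheory GRing.Theory Num.Theory.
Import numFieldNormedType.Exports.

(** Put [N = n - 1] and let [a i], [b j], [d s] be the multiplicities in the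
    cover of the lines [x = i], [y = j] and [x + y = s].  No line passes through
    the origin, so [a 0 = b 0 = 0], and the covering condition says that
    [K <= a i + b j + d (i + j)] for all [i, j <= N] not both zero (with [K = k]).
    The number of lines is at least the sum of these multiplicities over
    [1 <= i, j <= N] and [1 <= s <= 2 N].

    Fix a level [l < K].  If [mu, nu >= 0] and [mu + nu <= l], then
    [a i <= mu] and [b j <= nu] force [d (i + j) >= K - l].  A sumset of two sets
    of integers that contain [0] has at least as many nonzero elements as the two
    sets have together ([sumset_count]), so
      [#{s | d s >= K - l} >= #{i >= 1 | a i <= mu} + #{j >= 1 | b j <= nu}].
    Summed over [l], the left-hand side is at most the sum of the [d s]
    ([layer_cake]).

    For each level one may take any convex combination of such bounds over the
    admissible pairs [(mu, nu)].  The right-hand side then becomes a sum of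
    credits, one for each vertical and each horizontal line, where the credit of
    a line depends on its multiplicity [t] and on [l] only.  With
    [v = 1 / sqrt 2], the combinations of [vcredit] and [hcredit] are such that,
    over all levels, a line of multiplicity [t] collects at least [v K - t - 3]
    ([sum_vcredit], [sum_hcredit]).  Adding its own [t], each of the [2 N]
    vertical and horizontal lines accounts for [v K - 3], which gives
    [2 v K N - 6 N = sqrt 2 K N - 6 N] in total.

    The error [6 N] comes from rounding to integer levels and does not depend
    on [K].  Repeating every line [r] times multiplies the main term by [r] and
    leaves the error unchanged, so for [r] tending to infinity the error
    disappears ([total_ge]).  The bound [sqrt 2 * k * (n - 1)] therefore holds
    for every [n], and [eps = 0] is a valid choice.

    The convex combinations are a dual solution of the linear program for
    fractional covers.  In the limit of large [N], an optimal fractional cover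
    gives [x = i] and [y = i] the weight [v i / N], and [x + y = s] the weight
    [max (0, 1 - v s / N)].  By complementary slackness every line with positive
    weight has to be charged exactly, and this determines which densities the
    thresholds must sweep out: density one on [[0, v K]] for [a] and for [b]. *)

Set Implicit Arguments.
Unset Strict Implicit.
Unset Printing Implicit Defensive.

Local Open Scope classical_set_scope.
Local Open Scope ring_scope.

(** * Level sets of the multiplicities *)

(** If [m] is the largest element of [P], then [P + Q] contains [P + 0] up to [m]
    and [m + Q] above [m].  The element [0] of either set is not counted, and
    accordingly [g] is asked for nonzero sums only. *)
Lemma sumset_count (N : nat) (P Q g : pred nat) :
    P 0%N -> Q 0%N ->
    (forall i j, (i <= N)%N -> (j <= N)%N -> (0 < i + j)%N ->
       P i -> Q j -> g (i + j)%N) ->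
  (\sum_(1 <= i < N.+1) P i + \sum_(1 <= j < N.+1) Q j
     <= \sum_(1 <= s < (2 * N).+1) g s)%N.
Proof.
move=> P0 Q0 Pg.
have exP : exists i, (i <= N)%N && P i by exists 0%N; rewrite P0.
have leN i : ((i <= N)%N && P i -> i <= N)%N by move=> /andP[].
case: (ex_maxnP exP leN) => m /andP[mN Pm] max_m.
have tail0 : (\sum_(m.+1 <= i < N.+1) P i = 0)%N.
  rewrite big_nat big1 // => i /andP[mi iN]; case Pi: (P i) => //.
  by have := max_m i; rewrite Pi -ltnS iN => /(_ isT); lia.
rewrite (@big_cat_nat _ _ _ m.+1 1 N.+1) //= tail0.
rewrite addn0 (@big_cat_nat _ _ _ m.+1 1 (2 * N).+1) //=; last by lia.
rewrite (@big_cat_nat _ _ _ (m + N).+1 m.+1 (2 * N).+1) //=; [|lia|lia].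
rewrite addnA; apply: leq_trans (leq_addr _ _); apply: leq_add.
  rewrite big_nat [leqRHS]big_nat; apply: leq_sum => i /andP[i1 im].
  case Pi: (P i) => //.
  by have := Pg i 0%N; rewrite addn0 Pi => ->//; lia.
rewrite -[m.+1]add1n big_addn.
have -> : ((m + N).+1 - m = N.+1)%N by lia.
rewrite big_nat [leqRHS]big_nat; apply: leq_sum => i /andP[i1 iN].
case Qi: (Q i) => //.
by have := Pg m i; rewrite Pm Qi addnC => ->//; lia.
Qed.

Lemma layer_cake (K M : nat) (d : nat -> nat) :
  (\sum_(l < K) \sum_(1 <= s < M) (K <= d s + l) <= \sum_(1 <= s < M) d s)%N.
Proof.
rewrite exchange_big; apply: leq_sum => s _.
suff H n : (\sum_(l < n) (K <= d s + l) <= d s + n - K)%N.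
  by apply: leq_trans (H K) _; rewrite addnK.
elim: n => [|n IHn]; first by rewrite big_ord0.
rewrite big_ord_recr /=; move: (\sum_(l < n) _)%N IHn => S.
by case: (leqP K (d s + n)) => /= h; lia.
Qed.

(** * Counting levels in an interval *)

Section CountLevels.
Variable R : realFieldType.
Implicit Types (p q t : R).

Lemma count_lt_ge K q : q <= K%:R -> q <= \sum_(l < K) (l%:R < q)%R%:R.
Proof.
suff H n : n%:R <= (\sum_(l < n) (l%:R < q)%R%:R : R) \/ q <= \sum_(l < n) (l%:R < q)%R%:R.
  by case: (H K) => // KS qK; exact: le_trans qK KS.
elim: n => [|n IHn]; first by left; rewrite big_ord0.
rewrite big_ord_recr /= -natr1; case: (ltP n%:R q) => h /=; last by right; case: IHn => ?; lra.
by case: IHn => ?; [left|right]; lra.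
Qed.

Lemma count_lt_le K p : 0 <= p -> \sum_(l < K) (l%:R < p)%R%:R <= p + 1.
Proof.
move=> p0.
suff: \sum_(l < K) (l%:R < p)%R%:R <= p + 1 /\ \sum_(l < K) (l%:R < p)%R%:R <= K%:R :> R by case.
elim: K => [|n [IHn IHn']]; first by rewrite big_ord0; split => //; lra.
by rewrite big_ord_recr /= -natr1; case: (ltP n%:R p) => h /=; split; lra.
Qed.

Lemma count_itv K p q : 0 <= p -> q <= K%:R ->
  q - p - 1 <= \sum_(l < K) (p <= l%:R < q)%R%:R.
Proof.
move=> p0 qK.
have := count_lt_ge qK; have := count_lt_le K p0.
suff : \sum_(l < K) (l%:R < q)%R%:R <=
   \sum_(l < K) (p <= l%:R < q)%R%:R + \sum_(l < K) (l%:R < p)%R%:R :> R by lra.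
rewrite -big_split /=; apply: ler_sum => l _.
by case: (leP p l%:R) => h1; case: (ltP l%:R q) => h2 /=; lra.
Qed.

End CountLevels.

(** * The dual solution *)

Section Credits.
Variable R : realFieldType.
Implicit Types (v t : R).

(** The credits that vertical and horizontal lines of multiplicity [t] receive at
    level [l].  They come from the following convex combinations of threshold
    pairs [(mu, nu)] with [mu + nu = l], where [c = 1 - v] and [u = 2 v - 1]:
    - for [l < c K]: [(l, 0)] with weight [u], [(0, l)] with weight [1 - u];
    - for [c K <= l < v K]: [(l, 0)] with weight [u], [(0, l)] with weight [c],
      and with weight [c] the pair in which, as [l] grows, [mu] increases from [0]
      to [v K] and [nu] decreases from [c K] to [0];
    - for [v K <= l]: the pair in which [mu] increases from [0] to [v K] and [nu]
      decreases from [v K] to [c K].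
    A threshold [0] contributes no credit. *)
Definition vcredit v (K l : nat) t : R :=
  if l%:R < (1 - v) * K%:R then (2 * v - 1) * (t <= l%:R)%R%:R
  else if l%:R < v * K%:R then
    (2 * v - 1) * (t <= l%:R)%R%:R
      + (1 - v) * (t <= (1 + v) * (l%:R - (1 - v) * K%:R))%R%:R
  else (t <= (2 * v + 1) * (l%:R - v * K%:R))%R%:R.

Definition hcredit v (K l : nat) t : R :=
  if l%:R < (1 - v) * K%:R then (2 - 2 * v) * (t <= l%:R)%R%:R
  else if l%:R < v * K%:R then
    (1 - v) * (t <= l%:R)%R%:R + (1 - v) * (t <= K%:R / 2 - v * l%:R)%R%:R
  else (t <= (1 + v) * K%:R - 2 * v * l%:R)%R%:R.

(** Linear arithmetic needs a numerical enclosure of [1 / sqrt 2] to settle signs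
    such as those of [2 v - 1] and [1 - v]. *)
Lemma v_bounds v : 0 < v -> v * v = 1 / 2 -> 7 / 10 < v < 71 / 100.
Proof. by move=> v0 vv; apply/andP; split; nra. Qed.

(** The levels at which [t] is below a threshold form an interval for each of the
    three families of thresholds.  The lengths are [v K - t], [(2 - 2 v) (v K - t)]
    and [u (v K - t)], and their weights [u], [c] and [1] give
    [u + c (2 - 2 v) + u = 1], by [v ^ 2 = 1 / 2].  Each interval may lose one level
    to rounding. *)
Lemma sum_vcredit v (K : nat) t : 0 < v -> v * v = 1 / 2 -> 0 <= t ->
  v * K%:R - t - 3 <= \sum_(l < K) vcredit v K l t.
Proof.
move=> v0 vv t0; have /andP[v1 v2] := v_bounds v0 vv.
have k0 : 0 <= K%:R :> R by [].
have vk0 : 0 <= v * K%:R by nra.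
have vkK : v * K%:R <= K%:R by nra.
have cvK : (1 - v) * K%:R <= v * K%:R by nra.
have ck0 : 0 <= (1 - v) * K%:R by nra.
have vvt : v * v * t = t / 2 by rewrite vv; field.
have e1 := count_itv t0 vkK.
have e2 : v * K%:R - ((1 - v) * K%:R + (2 - 2 * v) * t) - 1 <= _ :=
  count_itv (_ : 0 <= (1 - v) * K%:R + (2 - 2 * v) * t) vkK.
have e3 := @count_itv _ K (v * K%:R + (2 * v - 1) * t) K%:R _ (lexx _).
apply: (@le_trans _ _ (\sum_(l < K) ((2 * v - 1) * (t <= l%:R < v * K%:R)%R%:R
   + (1 - v) * ((1 - v) * K%:R + (2 - 2 * v) * t <= l%:R < v * K%:R)%R%:R
   + (v * K%:R + (2 * v - 1) * t <= l%:R < K%:R)%R%:R))).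
  rewrite !big_split /= -!mulr_sumr.
  have {}e2 := e2 ltac:(nra). have {}e3 := e3 ltac:(nra).
  have u0 : 0 <= 2 * v - 1 by lra.
  have c0 : 0 <= 1 - v by lra.
  move/(ler_wpM2l u0): e1; move/(ler_wpM2l c0): e2; move: e3.
  have : v * v * K%:R = K%:R / 2 by rewrite vv; field.
  lra.
apply: ler_sum => l _; rewrite /vcredit.
have lK : l%:R < K%:R :> R by rewrite ltr_nat.
rewrite lK andbT.
case: (ltP l%:R ((1 - v) * K%:R)) => h1.
  have -> : l%:R < v * K%:R by lra.
  have -> : ((1 - v) * K%:R + (2 - 2 * v) * t <= l%:R) = false.
    by apply/negbTE; rewrite -ltNge; nra.
  have -> : (v * K%:R + (2 * v - 1) * t <= l%:R) = false.
    by apply/negbTE; rewrite -ltNge; nra.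
  by rewrite /= andbT; lra.
case: (ltP l%:R (v * K%:R)) => h2.
  have -> : (v * K%:R + (2 * v - 1) * t <= l%:R) = false.
    by apply/negbTE; rewrite -ltNge; nra.
  rewrite !andbT /= addr0 lerD2l.
  case: (leP _ l%:R) => /= h3; last by rewrite mulr0; apply: mulr_ge0; [lra|].
  suff -> : t <= (1 + v) * (l%:R - (1 - v) * K%:R) by rewrite mulr1.
  (* [1 + v] is the inverse of [2 - 2 v], since [v ^ 2 = 1 / 2]. *)
  have -> : t = (1 + v) * ((2 - 2 * v) * t) by lra.
  by apply: ler_wpM2l; lra.
rewrite !andbF /= !mulr0 !add0r.
case: (leP _ l%:R) => //= h3.
suff -> : t <= (2 * v + 1) * (l%:R - v * K%:R) by [].
(* [2 v + 1] is the inverse of [2 v - 1]. *)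
have -> : t = (2 * v + 1) * ((2 * v - 1) * t) by lra.
by apply: ler_wpM2l; lra.
Qed.

(** The decreasing thresholds make the set of levels depend on the position of [t]
    relative to [c K], the value that separates their two ranges.  For [t > c K]
    only two intervals remain, of lengths [v K - t] and [v (v K - t)], with
    weights [c] and [1], and [c + v = 1]. *)
Lemma sum_hcredit v (K : nat) t : 0 < v -> v * v = 1 / 2 -> 0 <= t ->
  v * K%:R - t - 3 <= \sum_(l < K) hcredit v K l t.
Proof.
move=> v0 vv t0; have /andP[v1 v2] := v_bounds v0 vv.
have k0 : 0 <= K%:R :> R by [].
have vk0 : 0 <= v * K%:R by nra.
have vkK : v * K%:R <= K%:R by nra.
have cvK : (1 - v) * K%:R <= v * K%:R by nra.
have ck0 : 0 <= (1 - v) * K%:R by nra.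
have vvt : v * v * t = t / 2 by rewrite vv; field.
have vvK : v * v * K%:R = K%:R / 2 by rewrite vv; field.
have c0 : 0 <= 1 - v by lra.
have vt0 : 0 <= v * t by apply: mulr_ge0; lra.
have [tc|ct] := leP t ((1 - v) * K%:R).
  have e1 := count_itv t0 (le_trans cvK vkK).
  have e2 := count_itv ck0 vkK.
  have e3 := @count_itv _ K _ (v * K%:R - 2 * (v * t)) ck0 ltac:(lra).
  have e4 := @count_itv _ K _ K%:R vk0 (lexx _).
  apply: (@le_trans _ _ (\sum_(l < K)
      ((2 - 2 * v) * (t <= l%:R < (1 - v) * K%:R)%R%:R
     + (1 - v) * ((1 - v) * K%:R <= l%:R < v * K%:R)%R%:R
     + (1 - v) * ((1 - v) * K%:R <= l%:R < v * K%:R - 2 * (v * t))%R%:R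
     + (v * K%:R <= l%:R < K%:R)%R%:R))).
    rewrite !big_split /= -!mulr_sumr.
    have u0 : 0 <= 2 - 2 * v by lra.
    move/(ler_wpM2l u0): e1; move/(ler_wpM2l c0): e2; move/(ler_wpM2l c0): e3.
    move: e4; lra.
  apply: ler_sum => l _; rewrite /hcredit.
  have lK : l%:R < K%:R :> R by rewrite ltr_nat.
  rewrite lK andbT.
  case: (ltP l%:R ((1 - v) * K%:R)) => h1.
    have -> : (v * K%:R <= l%:R) = false by apply/negbTE; rewrite -ltNge; lra.
    by rewrite /= andbT !mulr0 !addr0.
  case: (ltP l%:R (v * K%:R)) => h2.
    have -> : t <= l%:R by lra.
    rewrite andbF /= mulr0 add0r addr0 lerD2l.
    case: (ltP l%:R (v * K%:R - 2 * (v * t))) => /= h3; last first.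
      by rewrite mulr0; apply: mulr_ge0.
    suff -> : t <= K%:R / 2 - v * l%:R by [].
    have : v * l%:R <= v * (v * K%:R - 2 * (v * t)) by apply: ler_wpM2l; lra.
    lra.
  have -> : (l%:R < v * K%:R - 2 * (v * t)) = false.
    by apply/negbTE; rewrite -leNgt; lra.
  rewrite !andbF !mulr0 !add0r /=.
  suff -> : t <= (1 + v) * K%:R - 2 * v * l%:R by [].
  have : v * l%:R <= v * K%:R by apply: ler_wpM2l; lra.
  lra.
have e1 := count_itv t0 vkK.
have vct : v * ((1 - v) * K%:R) <= v * t by apply: ler_wpM2l; lra.
have e2 := @count_itv _ K _ (v * ((1 + v) * K%:R - t)) vk0 ltac:(lra).
apply: (@le_trans _ _ (\sum_(l < K)
    ((1 - v) * (t <= l%:R < v * K%:R)%R%:R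
     + (v * K%:R <= l%:R < v * ((1 + v) * K%:R - t))%R%:R))).
  rewrite !big_split /= -!mulr_sumr.
  move/(ler_wpM2l c0): e1; move: e2; lra.
apply: ler_sum => l _; rewrite /hcredit.
case: (ltP l%:R ((1 - v) * K%:R)) => h1.
  have -> : (v * K%:R <= l%:R) = false by apply/negbTE; rewrite -ltNge; lra.
  have -> : (t <= l%:R) = false by apply/negbTE; rewrite -ltNge; lra.
  by rewrite /= !mulr0 addr0.
case: (ltP l%:R (v * K%:R)) => h2.
  by rewrite andbT /= addr0 lerDl; apply: mulr_ge0.
rewrite andbF mulr0 add0r /=.
case: (ltP l%:R _) => //= h3.
suff -> : t <= (1 + v) * K%:R - 2 * v * l%:R by [].
have : v * l%:R <= v * (v * ((1 + v) * K%:R - t)) by apply: ler_wpM2l; lra.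
have vvvK : v * v * v * K%:R = v * K%:R / 2 by rewrite vv; field.
lra.
Qed.

(** * Bounding the total multiplicity *)

Section Levels.
Variables (N K : nat) (a b d : nat -> nat).
Hypotheses (a0 : a 0%N = 0%N) (b0 : b 0%N = 0%N).
(** The pairs with [i = 0] or [j = 0] are the grid points on the axes, where only
    two of the three lines are available. *)
Hypothesis cov : forall i j, (i <= N)%N -> (j <= N)%N -> (0 < i + j)%N ->
  (K <= a i + b j + d (i + j))%N.

Lemma sum_threshold_le_level (l : nat) (mu nu : R) : 0 <= mu -> 0 <= nu -> mu + nu <= l%:R ->
  \sum_(1 <= i < N.+1) ((a i)%:R <= mu)%R%:R + \sum_(1 <= j < N.+1) ((b j)%:R <= nu)%R%:R
   <= (\sum_(1 <= s < (2 * N).+1) (K <= d s + l)%N)%:R :> R.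
Proof.
move=> mu0 nu0 munu.
rewrite -!natr_sum -natrD ler_nat.
apply: (@sumset_count N (fun i => (a i)%:R <= mu) (fun j => (b j)%:R <= nu)
          (fun s => (K <= d s + l)%N)); rewrite ?a0 ?b0 // => i j iN jN ij ai bj.
have : ((a i + b j)%N <= l)%N by rewrite -(ler_nat R) natrD; lra.
by have := cov iN jN ij; lia.
Qed.

Lemma sum_credit_le_level v (l : nat) : 0 < v -> v * v = 1 / 2 -> (l < K)%N ->
  \sum_(1 <= i < N.+1) vcredit v K l (a i)%:R + \sum_(1 <= j < N.+1) hcredit v K l (b j)%:R
   <= (\sum_(1 <= s < (2 * N).+1) (K <= d s + l)%N)%:R :> R.
Proof.
move=> v0 vv lK; have /andP[v1 v2] := v_bounds v0 vv.
have {}lK : l%:R <= K%:R :> R by rewrite ler_nat; exact: ltnW.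
have l0 : 0 <= l%:R :> R by [].
have k0 : 0 <= K%:R :> R by [].
have vvK : v * v * K%:R = K%:R / 2 by rewrite vv; field.
have LA (mu : R) : 0 <= \sum_(1 <= i < N.+1) ((a i)%:R <= mu)%R%:R :> R by apply: sumr_ge0.
have LB (nu : R) : 0 <= \sum_(1 <= i < N.+1) ((b i)%:R <= nu)%R%:R :> R by apply: sumr_ge0.
have onlyA := sum_threshold_le_level l0 (lexx 0) (_ : l%:R + 0 <= l%:R).
have onlyB := sum_threshold_le_level (lexx 0) l0 (_ : 0 + l%:R <= l%:R).
have {}onlyA := le_trans (ler_wpDr (LB 0) (lexx _)) (onlyA ltac:(lra)).
have {}onlyB := le_trans (ler_wpDl (LA 0) (lexx _)) (onlyB ltac:(lra)).
have u0 : 0 <= 2 * v - 1 by lra.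
have c0 : 0 <= 1 - v by lra.
rewrite /vcredit /hcredit; case: (ltP l%:R ((1 - v) * K%:R)) => h1.
  rewrite -!mulr_sumr.
  move/(ler_wpM2l u0): onlyA; move/(ler_wpM2l c0): onlyB; lra.
case: (ltP l%:R (v * K%:R)) => h2.
  rewrite !big_split /= -!mulr_sumr.
  have vl : v * l%:R <= v * (v * K%:R) by apply: ler_wpM2l; lra.
  have mu0 : 0 <= (1 + v) * (l%:R - (1 - v) * K%:R) by apply: mulr_ge0; lra.
  have nu0 : 0 <= K%:R / 2 - v * l%:R by lra.
  have both := @sum_threshold_le_level l _ _ mu0 nu0 ltac:(lra).
  move/(ler_wpM2l u0): onlyA; move/(ler_wpM2l c0): onlyB.
  move/(ler_wpM2l c0): both; lra.
have vl : v * l%:R <= v * K%:R by apply: ler_wpM2l; lra.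
by apply: sum_threshold_le_level; [apply: mulr_ge0; lra | lra | lra].
Qed.

Lemma total_ge_approx v : 0 < v -> v * v = 1 / 2 ->
  2 * v * N%:R * K%:R - 6 * N%:R <=
  (\sum_(1 <= i < N.+1) a i + \sum_(1 <= j < N.+1) b j
   + \sum_(1 <= s < (2 * N).+1) d s)%:R :> R.
Proof.
move=> v0 vv.
have cake := layer_cake K (2 * N).+1 d.
rewrite -(ler_nat R) in cake.
apply: le_trans (_ : (\sum_(1 <= i < N.+1) (a i)%:R + \sum_(1 <= j < N.+1) (b j)%:R
   + \sum_(l < K) (\sum_(1 <= s < (2 * N).+1) (K <= d s + l)%N)%:R) <= _); last first.
  by rewrite natrD lerD //; [rewrite natrD !natr_sum | rewrite -natr_sum].
have lev : \sum_(1 <= i < N.+1) \sum_(l < K) vcredit v K l (a i)%:R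
    + \sum_(1 <= j < N.+1) \sum_(l < K) hcredit v K l (b j)%:R <=
   \sum_(l < K) (\sum_(1 <= s < (2 * N).+1) (K <= d s + l)%N)%:R.
  rewrite [X in X + _]exchange_big [X in _ + X]exchange_big -big_split /=.
  by apply: ler_sum => l _; exact: sum_credit_le_level.
have A : \sum_(1 <= i < N.+1) (v * K%:R - 3) <=
    \sum_(1 <= i < N.+1) ((a i)%:R + \sum_(l < K) vcredit v K l (a i)%:R).
  by apply: ler_sum => i _; have := sum_vcredit K v0 vv (ler0n R (a i)); lra.
have B : \sum_(1 <= i < N.+1) (v * K%:R - 3) <=
    \sum_(1 <= i < N.+1) ((b i)%:R + \sum_(l < K) hcredit v K l (b i)%:R).
  by apply: ler_sum => i _; have := sum_hcredit K v0 vv (ler0n R (b i)); lra.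
rewrite [leRHS]big_split sumr_const_nat subn1 -mulr_natr /= in A.
rewrite [leRHS]big_split sumr_const_nat subn1 -mulr_natr /= in B.
lra.
Qed.
End Levels.
End Credits.

(** Multiplying all multiplicities and [K] by [r] preserves the hypotheses; the
    error term of [total_ge_approx] stays the same and is negligible for large
    [r]. *)
Lemma total_ge (R : archiRealFieldType) (v : R) (N K : nat) (a b d : nat -> nat) :
    0 < v -> v * v = 1 / 2 -> a 0%N = 0%N -> b 0%N = 0%N ->
    (forall i j, (i <= N)%N -> (j <= N)%N -> (0 < i + j)%N ->
       (K <= a i + b j + d (i + j))%N) ->
  2 * v * K%:R * N%:R <=
  (\sum_(1 <= i < N.+1) a i + \sum_(1 <= j < N.+1) b j
   + \sum_(1 <= s < (2 * N).+1) d s)%:R :> R.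
Proof.
move=> v0 vv a0 b0 cov; set T := (_ + _ + _)%N.
have scaled r : 2 * v * N%:R * (r * K)%:R - 6 * N%:R <= r%:R * T%:R :> R.
  rewrite -[r%:R * _]natrM /T !mulnDr !big_distrr /=.
  apply: total_ge_approx => //; rewrite ?a0 ?b0 ?muln0 // => i j iN jN ij.
  by rewrite -!mulnDr leq_mul2l cov ?orbT.
rewrite leNgt; apply/negP; rewrite -subr_gt0; set dl := (_ - _) => dl0.
have := archi_boundP (_ : 0 <= 6 * N%:R / dl).
set r := Num.bound _ => /(_ (divr_ge0 _ (ltW dl0))).
rewrite ltr_pdivrMr // => /(_ (mulr_ge0 _ _)) h.
have := scaled r; rewrite natrM; have {}h := h ltac:(by []) ltac:(by []).
move: h; rewrite /dl; lra.
Qed.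

(** * Lines of a cover *)

Lemma sum_count_mem_le (T : eqType) (ls s : seq T) : uniq ls ->
  (\sum_(x <- ls) count_mem x s <= size s)%N.
Proof.
move=> uls; elim: s => [|y s IHs] /=; first by rewrite big1.
rewrite big_split /= -add1n leq_add // -big_mkcond sum1_count.
have -> : count (eq_op y) ls = count_mem y ls by apply: eq_count => x /=; rewrite eq_sym.
by rewrite count_uniq_mem // leq_b1.
Qed.

Lemma count_le_count_mem3 (T : eqType) (P : pred T) (x y z : T) (s : seq T) :
  (forall t, t \in s -> P t -> [\/ t = x, t = y | t = z]) ->
  (count P s <= count_mem x s + count_mem y s + count_mem z s)%N.
Proof.
elim: s => //= t s IHs sub.
have {}IHs := IHs (fun t' ts => sub t' (mem_behead (s := t :: s) ts)).
suff : (P t <= (t == x) + (t == y) + (t == z))%N by lia.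
case Pt: (P t) => //.
by case: (sub t (mem_head _ _) Pt) => ->; rewrite eqxx ?addn1 ?addnS.
Qed.

Section Lines.
Variable R : realType.
Implicit Types (x y s : R) (L : set (R * R)).

Definition vline x : set (R * R) := [set p | p.1 = x].
Definition hline y : set (R * R) := [set p | p.2 = y].
Definition dline s : set (R * R) := [set p | p.1 + p.2 = s].

Lemma has_slope0 L : has_slope 0 L -> exists y, L = hline y.
Proof.
by move=> [b ->]; exists b; apply/seteqP; split=> -[x y] /=; rewrite mul0r add0r.
Qed.

Lemma has_slopeN1 L : has_slope (-1) L -> exists s, L = dline s.
Proof.
by move=> [b ->]; exists b; rewrite /dline; apply/seteqP; split=> -[x y] /= h; lra.
Qed.

Lemma vline_inj : injective vline.
Proof. by move=> x y e; have : vline x (x, 0) by []; rewrite e. Qed.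

Lemma hline_inj : injective hline.
Proof. by move=> x y e; have : hline x (0, x) by []; rewrite e. Qed.

Lemma dline_inj : injective dline.
Proof.
move=> x y e; have : dline x (x, 0) by rewrite /dline /= addr0.
by rewrite e /dline /= addr0.
Qed.

Lemma vline_neq_hline x y : vline x <> hline y.
Proof.
move=> e; have : vline x (x, y + 1) by [].
by rewrite e /hline /= => {e} h; lra.
Qed.

Lemma vline_neq_dline x s : vline x <> dline s.
Proof.
move=> e; have : vline x (x, s - x + 1) by [].
by rewrite e /dline /= => {e} h; lra.
Qed.

Lemma hline_neq_dline y s : hline y <> dline s.
Proof.
move=> e; have : hline y (s - y + 1, y) by [].
by rewrite e /dline /= => {e} h; lra.
Qed.

Lemma sum_lines_le_size (N M : nat) (H : seq (set (R * R))) :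
  (\sum_(1 <= i < N) count_mem (vline i%:R) H
    + \sum_(1 <= j < N) count_mem (hline j%:R) H
    + \sum_(1 <= s < M) count_mem (dline s%:R) H <= size H)%N.
Proof.
pose lines (f : R -> set (R * R)) n := [seq f i%:R | i <- index_iota 1 n].
have uniq_lines f n : injective f -> uniq (lines f n).
  move=> f_inj; rewrite map_inj_uniq ?iota_uniq // => i j /f_inj/eqP.
  by rewrite eqr_nat => /eqP.
have := @sum_count_mem_le _ (lines vline N ++ lines hline N ++ lines dline M) H.
rewrite !big_cat !big_map /= addnA; apply.
rewrite !cat_uniq !uniq_lines //=; [|exact: dline_inj|exact: hline_inj|exact: vline_inj].
rewrite andbT; apply/andP; split; apply/hasPn => L.
  rewrite mem_cat => /orP[] /mapP[i _ ->]; apply/mapP => -[j _ /esym].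
    exact: vline_neq_hline.
  exact: vline_neq_dline.
by move=> /mapP[i _ ->]; apply/mapP => -[j _ /esym]; exact: hline_neq_dline.
Qed.
End Lines.

Theorem theorem1p5 (R : realType) :
  exists eps : nat -> R,
    eps n @[n --> \oo] --> (0 : R) /\
    forall (n k : nat), (0 < n)%N -> (0 < k)%N ->
    forall H : multiset (set (R * R)),
      is_cover (@std_grid R n) k H ->
      (forall L, L \in H -> [\/ has_slope 0 L, vertical L | has_slope (-1) L]) ->
      (Num.sqrt 2 + eps n) * k%:R * (n%:R - 1) <= (size H)%:R.
Proof.
exists (fun=> 0); split; first exact: cvg_cst.
move=> [//|N] k _ _ H [_ covered avoids] slopes.
rewrite addr0 -[N.+1%:R]natr1 addrK.
have sqrt2 : Num.sqrt 2 * Num.sqrt 2 = 2 :> R by rewrite -expr2 sqr_sqrtr.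
have sqrt2_gt0 : 0 < Num.sqrt 2 :> R by rewrite sqrtr_gt0.
pose a i := count_mem (vline (i%:R : R)) H.
pose b j := count_mem (hline (j%:R : R)) H.
pose d s := count_mem (dline (s%:R : R)) H.
have v0 : 0 < Num.sqrt 2 / 2 :> R by lra.
have vv : Num.sqrt 2 / 2 * (Num.sqrt 2 / 2) = 1 / 2 :> R by lra.
have a0 : a 0%N = 0%N by apply/count_memPn/negP => /avoids; apply.
have b0 : b 0%N = 0%N by apply/count_memPn/negP => /avoids; apply.
have cov i j : (i <= N)%N -> (j <= N)%N -> (0 < i + j)%N ->
    (k <= a i + b j + d (i + j))%N.
  move=> iN jN ij.
  have ij_neq0 : (i%:R, j%:R) <> (0, 0) :> R * R.
    by case=> /eqP; rewrite pnatr_eq0 => /eqP i0 /eqP; rewrite pnatr_eq0; lia.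
  apply: leq_trans (covered _ _ ij_neq0) _; first by exists i, j.
  apply: count_le_count_mem3 => L LH; rewrite in_setE => Lij.
  move: Lij; case: (slopes _ LH) => [/has_slope0 [y ->]|[x ->]|/has_slopeN1[s ->]] /= <-.
  - exact: Or32.
  - exact: Or31.
  - by rewrite -natrD; exact: Or33.
have := total_ge v0 vv a0 b0 cov.
have -> : 2 * (Num.sqrt 2 / 2) = Num.sqrt 2 :> R by field.
move=> /le_trans; apply; rewrite ler_nat; exact: sum_lines_le_size.
Qed.
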